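(* Let $T$ be a complete first-order theory with monster model $\mathcal M$, let $\boldsymbol e=a/E$, $\boldsymbol b=b_F$ and $\boldsymbol c=c_L$ be hyperimaginaries with $\boldsymbol c\in\operatorname{acl}(\boldsymbol b\boldsymbol e)$, and let $\boldsymbol c_0=\boldsymbol c,\boldsymbol c_1,\dots,\boldsymbol c_{m-1}$ ($m\ge1$) be all the distinct conjugates of $\boldsymbol c$ over $\boldsymbol b\boldsymbol e$. Put $p=\operatorname{tp}(\boldsymbol b/\boldsymbol e)$ and $\overline p=\operatorname{tp}(\boldsymbol b\boldsymbol c/\boldsymbol e)$, and for $n\ge 1$ let $K_n$ be the kernel of the natural projection $\pi_n:\operatorname{Gal}^n_{\operatorname L}(\overline p)\to\operatorname{Gal}^n_{\operatorname L}(p)$. Assume that $T$ is G-compact over $\boldsymbol e$ and that $$(\dag)\qquad \boldsymbol b\boldsymbol c_i\not\equiv^{\operatorname L}_{\boldsymbol e}\boldsymbol b\boldsymbol c_j\quad\text{for all distinct } i,j<m.$$ Then $K_n$ is finite for each finite $n\ge1$.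
   Context: Conventions: $\mathcal M$ is a ($\bar\kappa$-saturated) monster model of $T$; small means of cardinality $<\bar\kappa$; real tuples are sequences from $\mathcal M$ of small length. A hyperimaginary $b_F=b/F$ is the class of a real tuple $b$ modulo an $\emptyset$-type-definable equivalence relation $F$; small sequences of hyperimaginaries are treated as single hyperimaginaries. $E$ is an $\emptyset$-type-definable equivalence relation, $a$ a real tuple, $\boldsymbol e=a/E$. $\operatorname{Aut}_{\boldsymbol e}(\mathcal M)=\{f\in\operatorname{Aut}(\mathcal M): f(\boldsymbol e)=\boldsymbol e\}$; conjugates over $\boldsymbol b\boldsymbol e$ are images under automorphisms fixing $\boldsymbol b$ and $\boldsymbol e$, and $\boldsymbol c\in\operatorname{acl}(\boldsymbol b\boldsymbol e)$ means $\boldsymbol c$ has finitely many such conjugates. $\operatorname{Autf}_{\boldsymbol e}(\mathcal M)$ is the (normal) subgroup of $\operatorname{Aut}_{\boldsymbol e}(\mathcal M)$ generated by all $f\in\operatorname{Aut}_{\boldsymbol e}(\mathcal M)$ fixing pointwise some small model $M\prec\mathcal M$ with $\boldsymbol e\in\operatorname{dcl}(M)$ (i.e. $\boldsymbol e$ is fixed by all automorphisms fixing $M$ pointwise). $\boldsymbol u\equiv^{\operatorname L}_{\boldsymbol e}\boldsymbol v$ iff $f(\boldsymbol u)=\boldsymbol v$ for some $f\in\operatorname{Autf}_{\boldsymbol e}(\mathcal M)$. $\operatorname{Gal}_{\operatorname L}(T,\boldsymbol e)=\operatorname{Aut}_{\boldsymbol e}(\mathcal M)/\operatorname{Autf}_{\boldsymbol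 e}(\mathcal M)$ with projection $\pi$, topologized as follows: for small models $M,N$ with $\boldsymbol e\in\operatorname{dcl}(M)$, $\boldsymbol e\in\operatorname{dcl}(N)$, $S_M(N)=\{\operatorname{tp}(f(M)/N): f\in\operatorname{Aut}_{\boldsymbol e}(\mathcal M)\}$ has the relative Stone topology, and $\operatorname{Gal}_{\operatorname L}(T,\boldsymbol e)$ has the quotient topology under the well-defined map $\operatorname{tp}(f(M)/N)\mapsto\pi(f)$ (independent of $M,N$). $T$ is G-compact over $\boldsymbol e$ if the trivial subgroup is closed in $\operatorname{Gal}_{\operatorname L}(T,\boldsymbol e)$. Relativized Lascar groups: for a hyperimaginary $\boldsymbol d$ and $q=\operatorname{tp}(\boldsymbol d/\boldsymbol e)$, the realizations of $q$ are the images of $\boldsymbol d$ under $\operatorname{Aut}_{\boldsymbol e}(\mathcal M)$ and $q(\mathcal M)$ is the set of realizations. $\operatorname{Aut}(q)=\{f\upharpoonright q(\mathcal M): f\in\operatorname{Aut}_{\boldsymbol e}(\mathcal M)\}$. For a cardinal $\lambda>0$, $\operatorname{Autf}^\lambda(q)$ is the (normal) subgroup of those $f\in\operatorname{Aut}(q)$ such that $(\boldsymbol d_i)_{i<\lambda}\equiv^{\operatorname L}_{\boldsymbol e}(f(\boldsymbol d_i))_{i<\lambda}$ for every sequence $(\boldsymbol d_i)_{i<\lambda}$ of realizations of $q$. $\operatorname{Gal}^\lambda_{\operatorname L}(q)=\operatorname{Aut}(q)/\operatorname{Autf}^\lambda(q)$. The natural projection is $\pi_n\bigl((f\upharpoonright\overline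 p(\mathcal M))\cdot\operatorname{Autf}^n(\overline p)\bigr)=(f\upharpoonright p(\mathcal M))\cdot\operatorname{Autf}^n(p)$ for $f\in\operatorname{Aut}_{\boldsymbol e}(\mathcal M)$, which is well defined. *)

(* Defs.v *)
From HB Require Import structures.
From mathcomp Require Import all_boot.
From mathcomp Require Import mathcomp_extra boolp classical_sets functions.
From mathcomp Require Import cardinality topology.

Set Implicit Arguments.
Unset Strict Implicit.
Unset Printing Implicit Defensive.

Local Open Scope classical_set_scope.
Local Open Scope card_scope.

Record language := Language {
  fun_sym : Type;
  fun_ar : fun_sym -> nat;
  rel_sym : Type;
  rel_ar : rel_sym -> nat }.

Inductive term (L : language) (V : Type) : Type :=
| Var (v : V)
| App (s : fun_sym L) (args : 'I_(fun_ar s) -> term L V).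

(* The free variables of a formula are indexed by an arbitrary type [V]; a
   quantifier binds the variable [None : option V]. *)
Inductive formula (L : language) (V : Type) : Type :=
| Bot
| Eq (t u : term L V)
| Rel (r : rel_sym L) (args : 'I_(rel_ar r) -> term L V)
| Imp (phi psi : formula L V)
| All (phi : formula L (option V)).

Arguments Bot {L V}.

(* The carrier may be empty here; nonemptiness is part of [model]. *)
Record structure (L : language) := Structure {
  carrier :> Type;
  fun_int : forall s : fun_sym L, ('I_(fun_ar s) -> carrier) -> carrier;
  rel_int : forall r : rel_sym L, ('I_(rel_ar r) -> carrier) -> Prop }.

Fixpoint eval L (M : structure L) (V : Type) (x : V -> M) (t : term L V) : M :=
  match t with
  | Var v => x v
  | App s args => fun_int (fun i => eval x (args i))
  end.

Fixpoint sat L (M : structure L) (V : Type) (phi : formula L V) : (V -> M) -> Prop :=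
  match phi with
  | Bot => fun=> False
  | Eq t u => fun x => eval x t = eval x u
  | Rel r args => fun x => rel_int (fun i => eval x (args i))
  | Imp phi psi => fun x => sat phi x -> sat psi x
  | All phi => fun x => forall m : M, sat phi (fun o => oapp x m o)
  end.

Definition sentence L := formula L void.

Definition models L (N : structure L) (phi : sentence L) : Prop :=
  sat phi (of_void N).

Definition model L (T : set (sentence L)) (N : structure L) : Prop :=
  inhabited N /\ T `<=` models N.

Definition entails L (T : set (sentence L)) (phi : sentence L) : Prop :=
  forall N : structure L, model T N -> models N phi.

Definition complete_theory L (T : set (sentence L)) : Prop :=
  (exists N, model T N) /\
  (forall phi, entails T phi \/ entails T (Imp phi Bot)).

Definition join (I J X : Type) (x : I -> X) (y : J -> X) (k : I + J) : X :=
  match k with inl i => x i | inr j => y j end.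

Definition fun_closed L (M : structure L) (A : set M) : Prop :=
  forall (s : fun_sym L) (args : 'I_(fun_ar s) -> M),
    (forall i, A (args i)) -> A (fun_int args).

Definition substructure L (M : structure L) (A : set M) (cA : fun_closed A) :
    structure L :=
  @Structure L (set_type A)
    (fun s args => exist _ (fun_int (fun i => val (args i)))
       (mem_set (cA s _ (fun i => set_valP (args i)))))
    (fun r args => rel_int (fun i => val (args i))).

(* [V] ranges over all types, hence over [void]: when M is nonempty, this
   excludes the empty set. *)
Definition elementary L (M : structure L) (A : set M) : Prop :=
  exists cA : fun_closed A,
  forall (V : Type) (phi : formula L V) (x : V -> substructure cA),
    sat phi x <-> @sat L M V phi (fun v => val (x v)).

Definition automorphism L (M : structure L) (f : M -> M) : Prop :=
  [/\ bijective f,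
      forall (s : fun_sym L) (args : 'I_(fun_ar s) -> M),
        f (fun_int args) = fun_int (f \o args) &
      forall (r : rel_sym L) (args : 'I_(rel_ar r) -> M),
        rel_int args <-> rel_int (f \o args)].

Arguments automorphism {L} M.

(* Cardinals are represented by types; [kappa] stands for its cardinality. *)
Definition small (kappa : Type) (I : Type) : Prop :=
  ([set: I] #<= [set: kappa]) && ~~ ([set: kappa] #<= [set: I]).

Definition saturated L (M : structure L) (kappa : Type) : Prop :=
  forall A : set M, small kappa A ->
  forall Sigma : set (formula L (unit + A)),
    (forall Delta, finite_set Delta -> Delta `<=` Sigma ->
       exists x : M, forall phi, Delta phi -> sat phi (join (fun=> x) val)) ->
    exists x : M, forall phi, Sigma phi -> sat phi (join (fun=> x) val).

Definition strongly_homogeneous L (M : structure L) (kappa : Type) : Prop :=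
  forall I : Type, small kappa I -> forall u v : I -> M,
    (forall phi : formula L I, sat phi u <-> sat phi v) ->
    exists2 f, automorphism M f & f \o u = v.

(* [small kappa (formula L nat)] says that |L| + aleph_0 < kappa. *)
Definition monster L (T : set (sentence L)) (kappa : Type) (M : structure L) :
    Prop :=
  [/\ model T M, small kappa (formula L nat), saturated M kappa &
      strongly_homogeneous M kappa].

(* Type-definable over the empty set: Sigma has no parameters. *)
Record tdeq L (M : structure L) (I : Type) := TDEq {
  tdrel :> (I -> M) -> (I -> M) -> Prop;
  tdrel_refl : forall x, tdrel x x;
  tdrel_sym : forall x y, tdrel x y -> tdrel y x;
  tdrel_trans : forall x y z, tdrel x y -> tdrel y z -> tdrel x z;
  tdrel_def : exists Sigma : set (formula L (I + I)),
    forall x y, tdrel x y <-> (forall phi, Sigma phi -> sat phi (join x y)) }.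

(* Hyperimaginaries are equivalence classes, as sets of tuples. *)
Definition hclass L (M : structure L) I (F : tdeq M I) (x : I -> M) :
    set (I -> M) :=
  [set y : I -> M | F x y].

(* For X = x/F and Y = y/G, [hpair X Y] is the class of the concatenation [x y]
   modulo the equivalence relation given by F on the first I coordinates and by
   G on the last J ones. *)
Definition hpair (M I J : Type) (X : set (I -> M)) (Y : set (J -> M)) :
    set (I + J -> M) :=
  [set z : I + J -> M | X (z \o inl) /\ Y (z \o inr)].

(* The image of a hyperimaginary under f; for f an automorphism, f(x/F) is
   (f(x))/F. *)
Definition hact (M I : Type) (f : M -> M) (X : set (I -> M)) : set (I -> M) :=
  [set f \o x | x in X].

Definition subgroup (X : Type) (H : set (X -> X)) : Prop :=
  [/\ H id,
      forall f g, H f -> H g -> H (f \o g) &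
      forall f g, H f -> cancel f g -> cancel g f -> H g].

Definition generated (X : Type) (S : set (X -> X)) : set (X -> X) :=
  smallest (@subgroup X) S.

Definition lcoset (X : Type) (f : X -> X) (H : set (X -> X)) : set (X -> X) :=
  [set f \o h | h in H].

Definition quotient (X : Type) (G H : set (X -> X)) : set (set (X -> X)) :=
  [set lcoset f H | f in G].

(* As with [restr_perm], the restriction of a permutation f to a set A that f
   preserves is represented by the permutation that is f on A and the identity
   outside A. *)
Definition restr (X : Type) (A : set X) (f : X -> X) : X -> X := patch id A f.

Section LascarGroup.
Variables (L : language) (M : structure L) (kappa : Type).
Variables (K : Type) (e : set (K -> M)).

Definition Aut_over : set (M -> M) :=
  [set f | automorphism M f /\ hact f e = e].

Definition in_dcl (A : set M) : Prop :=
  forall f, automorphism M f -> (forall x, A x -> f x = x) -> hact f e = e.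

Definition small_model_dcl (A : set M) : Prop :=
  [/\ elementary A, small kappa A & in_dcl A].

Definition Autf_over : set (M -> M) :=
  generated [set f | Aut_over f /\
    exists2 A, small_model_dcl A & forall x, A x -> f x = x].

Definition Lascar_eq I (u v : set (I -> M)) : Prop :=
  exists2 f, Autf_over f & hact f u = v.

Definition Lascar_eq_seq (Lam I : Type) (u v : Lam -> set (I -> M)) : Prop :=
  exists2 f, Autf_over f & forall i, hact f (u i) = v i.

Definition GalL : set (set (M -> M)) := quotient Aut_over Autf_over.

Definition GalL_proj (f : M -> M) (Hf : Aut_over f) : GalL :=
  exist _ (lcoset f Autf_over) (mem_set (imageP _ Hf)).

End LascarGroup.

(* The sets of formulas in the variables V, with the topology generated by the
   sets {p | phi \in p}; on the complete types it is the Stone topology. *)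
Definition type_space (L : language) (V : Type) : Type := set (formula L V).

HB.instance Definition _ (L : language) (V : Type) :=
  gen_eqMixin (formula L V).
HB.instance Definition _ (L : language) (V : Type) :=
  gen_choiceMixin (formula L V).
HB.instance Definition _ (L : language) (V : Type) :=
  isPointed.Build (formula L V) Bot.
HB.instance Definition _ (L : language) (V : Type) :=
  Choice.copy (type_space L V) (set (formula L V)).
HB.instance Definition _ (L : language) (V : Type) :=
  @isSubBaseTopological.Build (type_space L V) (formula L V) setT
    (fun phi => [set p | p phi]).

Section LascarTopology.
Variables (L : language) (M : structure L) (kappa : Type).
Variables (K : Type) (e : set (K -> M)) (A B : set M).

(* tp(f(A)/B), where A is enumerated by itself. *)
Definition tp_image (f : M -> M) : type_space L (A + B) :=
  [set phi | sat phi (join (fun x : A => f (val x)) (fun x : B => val x))].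

(* S_A(B); as a type it carries the subspace topology of [type_space]. *)
Definition type_set : set (type_space L (A + B)) :=
  [set tp_image f | f in Aut_over e].

(* The map tp(f(A)/B) |-> pi(f).  When A and B are small models with e in
   dcl(A) and dcl(B), the value does not depend on the chosen f. *)
Definition type_to_GalL (p : type_set) : GalL kappa e :=
  let w := cid2 (set_valP p) in GalL_proj kappa (s2valP w).

End LascarTopology.

Arguments tp_image {L M} A B f.
Arguments type_set {L M K} e A B.
Arguments type_to_GalL {L M} kappa {K} e A B p.

(* A copy of GalL, tagged with the small models that define its topology. *)
Definition GalL_space L (M : structure L) kappa K (e : set (K -> M))
  (A B : set M) : Type := GalL kappa e.

Section LascarQuotientTopology.
Variables (L : language) (M : structure L) (kappa : Type).
Variables (K : Type) (e : set (K -> M)) (A B : set M).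
Local Notation G := (GalL_space kappa e A B).

HB.instance Definition _ := Choice.on G.

Definition GalL_open (U : set G) : Prop :=
  open (type_to_GalL kappa e A B @^-1` U).

Lemma GalL_openT : GalL_open setT.
Proof. by rewrite /GalL_open preimage_setT; exact: openT. Qed.

Lemma GalL_openI : setI_closed GalL_open.
Proof. by move=> U V; exact: openI. Qed.

Lemma GalL_open_bigcup (D : Type) (U : D -> set G) :
  (forall i, GalL_open (U i)) -> GalL_open (\bigcup_i U i).
Proof. by move=> oU; apply: bigcup_open => i _; exact: oU. Qed.

HB.instance Definition _ :=
  @isOpenTopological.Build G GalL_open GalL_openT GalL_openI GalL_open_bigcup.

End LascarQuotientTopology.

(* The topology does not depend on the small models A and B, so one choice of
   them is as good as any other.  The trivial subgroup of GalL is {Autf}. *)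
Definition G_compact L (M : structure L) kappa K (e : set (K -> M)) : Prop :=
  exists A B : set M,
    [/\ small_model_dcl kappa e A, small_model_dcl kappa e B &
        closed [set g : GalL_space kappa e A B |
                 val g = lcoset id (Autf_over kappa e)]].

Section Relativized.
Variables (L : language) (M : structure L) (kappa : Type).
Variables (K : Type) (e : set (K -> M)).

(* The set q(M) of realizations of q = tp(d/e); a type is represented by its
   set of realizations. *)
Definition realizations I (d : set (I -> M)) : set (set (I -> M)) :=
  [set hact f d | f in Aut_over e].

Definition Aut_rel I (q : set (set (I -> M))) :
    set (set (I -> M) -> set (I -> M)) :=
  [set restr q (hact f) | f in Aut_over e].

(* The cardinal lambda is the cardinality of the type [Lam]. *)
Definition Autf_rel (Lam I : Type) (q : set (set (I -> M))) :
    set (set (I -> M) -> set (I -> M)) :=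
  [set s | Aut_rel q s /\
    forall d : Lam -> set (I -> M), (forall i, q (d i)) ->
      Lascar_eq_seq kappa e d (s \o d)].

Definition GalL_rel (Lam I : Type) (q : set (set (I -> M))) :
    set (set (set (I -> M) -> set (I -> M))) :=
  quotient (Aut_rel q) (Autf_rel Lam q).

Section Projection.
Variables (Lam I J : Type) (b : set (I -> M)) (c : set (J -> M)).

Let p := realizations b.
Let pbar := realizations (hpair b c).

(* The image of a coset C is the union of the cosets of the restrictions to
   p(M) of the f in Aut_e(M) whose restriction to pbar(M) is in C.  For
   C = (f | pbar(M)) Autf(pbar), these are all (f | p(M)) Autf(p). *)
Definition GalL_rel_proj (C : set (set (I + J -> M) -> set (I + J -> M))) :
    set (set (I -> M) -> set (I -> M)) :=
  \bigcup_(f in [set f | Aut_over e f /\ C (restr pbar (hact f))])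
    lcoset (restr p (hact f)) (Autf_rel Lam p).

Definition GalL_rel_kernel : set (set (set (I + J -> M) -> set (I + J -> M))) :=
  [set C | GalL_rel Lam pbar C /\
    GalL_rel_proj C = lcoset id (Autf_rel Lam p)].

End Projection.
End Relativized.

Definition conjugates L (M : structure L) I J K
    (b : set (I -> M)) (e : set (K -> M)) (c : set (J -> M)) :
    set (set (J -> M)) :=
  [set hact f c | f in Aut_over b `&` Aut_over e].

Definition in_acl L (M : structure L) I J K
    (c : set (J -> M)) (b : set (I -> M)) (e : set (K -> M)) : Prop :=
  finite_set (conjugates b e c).

(* Main.v *)
From mathcomp Require Import all_boot.
From mathcomp Require Import boolp classical_sets functions.
From mathcomp Require Import cardinality topology.
Require Import Defs.

(** Write d for the hyperimaginary bc, d_j for b c_j, and call f in Aut_e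
   good when f moves every n-tuple of realizations of p inside its Lascar
   class over e. The elements of K_n are the cosets of the good
   automorphisms, so the point is that finitely many data decide when a good
   f is trivial, that is, when f moves every n-tuple of realizations of
   tp(d/e) inside its Lascar class.

   Reduction to single realizations. Let f be good and let f (g_i d) be
   Lascar equivalent to g_i d for each i. As f is good, some strong
   automorphism h agrees with f on all the g_i b. Then h^-1 f fixes each g_i
   b, so it maps g_i d to some g_i d_j; both are Lascar equivalent, and
   (dag) forces j = 0. Hence f and h agree on the g_i d simultaneously. So f
   is trivial as soon as f (g d) is Lascar equivalent to g d for every
   single conjugate g d ([fixing] in the last proof).

   Reduction to finitely many realizations. For a good f and any g in Aut_e,
   f (g d) is Lascar equivalent to some g d_j, and f acts trivially at g d
   when j = 0. Lemma [separation] says that this triviality is locally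
   constant in g: for a fixed representative d0 of d there is a finite set
   Delta of formulas over a small model A such that, if g d0 and g' d0
   satisfy the same formulas of Delta, then f cannot be trivial at g d and
   send g' d to the class of g' d_j with j <> 0. As there are finitely many
   Delta-classes, triviality has to be tested at finitely many
   representatives only; if two good automorphisms send each of these g d to
   the class of the same g d_j, then they differ by a trivial one, so they
   lie in the same coset. There are finitely many functions from
   representatives to indices j, so there are finitely many cosets.

   Lemma [separation] is a compactness argument. Were there no Delta, one
   would have automorphisms g, g', f in Aut_e and a strong h, for each
   Delta, with f (g d) = g d and h f (g' d) = g' d_j. In the limit along the
   finite sets Delta these equations persist, now with g d and g' d of the
   same type over A; and the limit of the h is again strong, because
   G-compactness says that being strong is a closed condition on the type of
   (h(A), B) ([G_compact_closed]). But then some strong k maps g d to g' d,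
   and conjugating by k shows that f is trivial at g' d, which contradicts
   (dag). That such limits of automorphisms exist ([limit_automorphisms]) is
   saturation for types in a small number of variables ([compactness])
   together with strong homogeneity. *)

Set Implicit Arguments.
Unset Strict Implicit.
Unset Printing Implicit Defensive.

Local Open Scope classical_set_scope.
Local Open Scope card_scope.

(** * Arithmetic of small cardinals *)

Definition embeds (X Y : Type) : Prop := exists f : X -> Y, injective f.

Lemma card_le_embeds X Y (A : set X) (B : set Y) : (A #<= B) <-> embeds A B.
Proof.
split=> [/card_leP/injfunPex[f _ fI]|[f fI]].
  by exists f => x y; apply: fI; rewrite in_setT.
by apply/card_leP/injfunPex; exists f => // x y _ _ /fI.
Qed.

Lemma card_leTP X Y : ([set: X] #<= [set: Y]) <-> embeds X Y.
Proof.
rewrite card_le_embeds; split=> [[f fI]|[f fI]].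
  exists (fun x => val (f (SigSub (in_setT x)))) => x y /val_inj/fI.
  by move=> [].
exists (fun x => SigSub (in_setT (f (val x)))) => x y [/fI].
exact: val_inj.
Qed.

Lemma embeds_trans X Y Z : embeds X Y -> embeds Y Z -> embeds X Z.
Proof. by move=> [f fI] [g gI]; exists (g \o f); exact: inj_comp. Qed.

(** A maximal partial bijection is total on one side. *)
Lemma embeds_total X Y : embeds X Y \/ embeds Y X.
Proof.
pose P (G : set (X * Y)) := forall p q, G p -> G q -> (p.1 = q.1) <-> (p.2 = q.2).
have [F FP totF|G [PG maxG]] := @Zorn_bigcup _ P.
  move=> p q [A FA Ap] [B FB Bq].
  have [AB|BA] := totF _ _ FA FB; first exact: (FP _ FB _ _ (AB _ Ap) Bq).
  exact: (FP _ FA _ _ Ap (BA _ Bq)).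
have [domG|] := pselect (forall x, exists y, G (x, y)).
  have [f fG] := choice domG; left; exists f => x x' xx'.
  exact: (PG _ _ (fG x) (fG x')).2.
move=> /existsNP[x /forallNP nx].
have [ranG|] := pselect (forall y, exists x, G (x, y)).
  have [f fG] := choice ranG; right; exists f => y y' yy'.
  exact: (PG _ _ (fG y) (fG y')).1.
move=> /existsNP[y /forallNP ny]; exfalso.
have GP : G `<` (x, y) |` G.
  by split=> [z|/(_ (x, y) (or_introl erefl))/nx//]; right.
apply: (maxG _ GP) => p q [->|Gp] [->|Gq] /=; split=> //.
- by move=> xq; case: (nx q.2); rewrite xq -surjective_pairing.
- by move=> yq; case: (ny q.1); rewrite yq -surjective_pairing.
- by move=> xp; case: (nx p.2); rewrite -xp -surjective_pairing.
- by move=> yp; case: (ny p.1); rewrite -yp -surjective_pairing.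
- by move=> e; apply: (PG _ _ Gp Gq).1.
- by move=> e; apply: (PG _ _ Gp Gq).2.
Qed.

(** A maximal disjoint family of copies of nat leaves out finitely many points.
   These are absorbed by one member of the family, so X is covered by disjoint
   countable sets; and nat absorbs nat * nat. *)
Lemma embeds_natX X : embeds nat X -> embeds (nat * X) X.
Proof.
move=> [i0 i0I].
pose P (C : set (nat -> X)) := (forall f, C f -> injective f) /\
  forall f g m n, C f -> C g -> f m = g n -> f = g.
have [F FP totF|C [[CI Cd] maxC]] := @Zorn_bigcup _ P.
  split=> [f [A /FP[AI _] /AI]//|f g m n [A FA Af] [B FB Bg]].
  have [AB|BA] := totF _ _ FA FB; first exact: ((FP _ FB).2 _ _ _ _ (AB _ Af) Bg).
  exact: ((FP _ FA).2 _ _ _ _ Af (BA _ Bg)).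
pose rest := [set x | forall f n, C f -> f n <> x].
have rest_fin : finite_set rest.
  apply: contrapT => /infiniteP/card_le_embeds[h hI].
  pose g n := val (h (SigSub (in_setT n))).
  have gI : injective g by move=> m n /val_inj/hI[].
  have grest n : rest (g n) by exact: set_valP.
  have nCg : ~ C g by move=> Cg; exact: (grest 0 g 0 Cg).
  have CP : C `<` g |` C by split=> [z|/(_ g (or_introl erefl))//]; right.
  apply: (maxC _ CP); split=> [f [->|/CI]//|f k m n [->|Cf] [->|Ch] //].
  - by move=> e; case: (grest m k n Ch).
  - by move=> e; case: (grest n f m Cf).
  - exact: Cd.
have [f0 Cf0] : exists f, C f.
  apply: contrapT => /forallNP nC.
  have Xrest : [set: X] `<=` rest by move=> x _ f n /nC.
  have /finite_setPn := sub_finite_set Xrest rest_fin; apply.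
  by apply/card_leTP; exists i0.
have [r rI] : exists r : X -> nat, {in rest &, injective r}.
  exact/countable_injP/finite_set_countable.
(* even codes number the members of the family, odd ones the points left out *)
have /choice[code codeP] x : exists fk : (nat -> X) * nat, C fk.1 /\
    ((exists2 k, fk.2 = k.*2 & fk.1 k = x) \/
     [/\ rest x, fk.1 = f0 & fk.2 = (r x).*2.+1]).
  have [rx|] := pselect (rest x).
    by exists (f0, (r x).*2.+1); split=> //; right.
  move=> /existsNP[f /existsNP[k /not_implyP[Cf /contrapT fk]]].
  by exists (f, k.*2); split=> //; left; exists k.
have code_inj : injective code.
  move=> x y xy; have := codeP x; rewrite xy => -[_ hx].
  have [_ hy] := codeP y.
  case: hx => [[k ek fk]|[rx _ ex]]; case: hy => [[l el fl]|[ry _ ey]].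
  - have kl : k = l by rewrite -[k]doubleK -ek el doubleK.
    by rewrite -fk kl fl.
  - by have := congr1 odd ek; rewrite ey /= !odd_double.
  - by have := congr1 odd ex; rewrite el /= !odd_double.
  - apply: rI; rewrite ?inE //.
    by apply: double_inj; apply: succn_inj; rewrite -ex ey.
exists (fun nx => (code nx.2).1 (pickle (nx.1, (code nx.2).2))).
move=> [m x] [n y] /= e.
have [Cx _] := codeP x; have [Cy _] := codeP y.
have exy := Cd _ _ _ _ Cx Cy e; move: e; rewrite -exy => /(CI _ Cx).
move=> /(pcan_inj (@pickleK _))[-> e2]; congr pair; apply: code_inj.
by rewrite [LHS]surjective_pairing [RHS]surjective_pairing exy e2.
Qed.

Section Small.
Variable kappa : Type.

(** Cardinals are comparable, so the first half of smallness follows from the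
   second. *)
Lemma smallP X : small kappa X <-> ~ embeds kappa X.
Proof.
split=> [/andP[_ /negP nX] /card_leTP//|nX]; apply/andP; split.
  by apply/card_leTP; have [|] := embeds_total X kappa.
by apply/negP => /card_leTP.
Qed.

Lemma small_embeds X Y : embeds X Y -> small kappa Y -> small kappa X.
Proof. by move=> XY /smallP nY; apply/smallP => /embeds_trans/(_ XY). Qed.

Hypothesis small_nat : small kappa nat.

Lemma small_natX X : small kappa X -> small kappa (nat * X).
Proof.
have [|[f fI]] := embeds_total nat X.
  by move=> /embeds_natX; exact: small_embeds.
move=> _; apply: (small_embeds _ small_nat).
exists (fun nx => pickle (nx.1, f nx.2)) => -[m x] [n y].
by move=> /(pcan_inj (@pickleK _))[-> /fI ->].
Qed.

Lemma small_sum X Y : small kappa X -> small kappa Y -> small kappa (X + Y).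
Proof.
have [[f fI]|[f fI]] := embeds_total X Y => sX sY.
  apply: (small_embeds _ (small_natX sY)).
  by exists (fun z => match z with inl x => (0, f x) | inr y => (1, y) end);
     move=> [x|y] [x'|y'] // [] => [/fI->|->].
apply: (small_embeds _ (small_natX sX)).
by exists (fun z => match z with inl x => (0, x) | inr y => (1, f y) end);
   move=> [x|y] [x'|y'] // [] => [->|/fI->].
Qed.

Lemma small_words (D : countType) X : small kappa X -> small kappa (seq D * X).
Proof.
move=> sX; apply: (small_embeds _ (small_natX sX)).
exists (fun wx => (pickle wx.1, wx.2)) => -[v x] [w y].
by move=> [/(pcan_inj (@pickleK _))-> ->].
Qed.

End Small.

(** * Finitary manipulations of formulas *)

Section Syntax.
Variable L : language.

Fixpoint rename_term V W (r : V -> W) (t : term L V) : term L W :=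
  match t with
  | Var v => Var L (r v)
  | App s args => App (fun i => rename_term r (args i))
  end.

Fixpoint rename V W (r : V -> W) (phi : formula L V) : formula L W :=
  match phi with
  | Bot => Bot
  | Eq t u => Eq (rename_term r t) (rename_term r u)
  | Rel s args => Rel (fun i => rename_term r (args i))
  | Imp phi psi => Imp (rename r phi) (rename r psi)
  | All phi => All (rename (omap r) phi)
  end.

Definition Neg V (phi : formula L V) : formula L V := Imp phi Bot.
Definition Ex V (phi : formula L (option V)) : formula L V := Neg (All (Neg phi)).
Definition And V (phi psi : formula L V) : formula L V := Neg (Imp phi (Neg psi)).

Variable M : structure L.

Lemma eval_rename V W (r : V -> W) t (x : W -> M) :
  eval x (rename_term r t) = eval (x \o r) t.
Proof.
elim: t => //= s args IH; congr fun_int.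
by apply: funext => i; exact: IH.
Qed.

Lemma sat_rename V W (r : V -> W) (phi : formula L V) (x : W -> M) :
  sat (rename r phi) x <-> sat phi (x \o r).
Proof.
elim: phi W r x => [|{}V t u|{}V s args|{}V phi IH psi IH'|{}V phi IH] W r x //=.
- by rewrite !eval_rename.
- suff -> : (fun i => eval x (rename_term r (args i))) =
    (fun i => eval (x \o r) (args i)) by [].
  by apply: funext => i; exact: eval_rename.
- by rewrite IH IH'.
- have e m : (fun o => oapp x m o) \o omap r = (fun o => oapp (x \o r) m o).
    by apply: funext => -[].
  by split=> h m; have := h m; rewrite IH e.
Qed.

Lemma sat_Ex V (phi : formula L (option V)) (x : V -> M) :
  sat (Ex phi) x <-> exists m, sat phi (fun o => oapp x m o).
Proof.
split=> [h|[m hm] /(_ m)]; last exact.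
by apply: contrapT => /forallNP.
Qed.

Lemma sat_And V (phi psi : formula L V) (x : V -> M) :
  sat (And phi psi) x <-> sat phi x /\ sat psi x.
Proof.
split=> [h|[h1 h2] /(_ h1)]; last exact.
by apply: contrapT => /not_andP[n|n]; apply: h => //= ? ?; exact: n.
Qed.

Lemma eval_support V (t : term L V) :
  exists2 S, finite_set S &
    forall x y : V -> M, (forall v, S v -> x v = y v) -> eval x t = eval y t.
Proof.
elim: t => [v|s args].
  by exists [set v] => [|x y xy]; [exact: finite_set1|apply: xy].
move=> /(_ _)/cid2-/all_sig2[S Sfin Ssup].
exists (\bigcup_i S i); first exact: bigcup_finite.
move=> x y xy /=; congr fun_int; apply: funext => i; apply: Ssup => v Sv.
by apply: xy; exists i.
Qed.

Lemma sat_support V (phi : formula L V) :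
  exists2 S, finite_set S & forall x y : V -> M,
    (forall v, S v -> x v = y v) -> sat phi x -> sat phi y.
Proof.
elim: phi => [{}V|{}V t u|{}V s args|{}V phi [S Sf hS] psi [S' Sf' hS']|{}V phi [S Sf hS]].
- by exists set0.
- have [S Sf hS] := eval_support t; have [S' Sf' hS'] := eval_support u.
  exists (S `|` S') => [|x y xy /=]; first by rewrite finite_setU.
  by rewrite (hS x y) ?(hS' x y) // => v ?; apply: xy; [right|left].
- have /all_sig2[S Sf hS] i := cid2 (eval_support (args i)).
  exists (\bigcup_i S i) => [|x y xy /=]; first exact: bigcup_finite.
  suff -> : (fun i => eval x (args i)) = (fun i => eval y (args i)) by [].
  by apply: funext => i; apply: hS => v Sv; apply: xy; exists i.
- exists (S `|` S') => [|x y xy /= h hy]; first by rewrite finite_setU.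
  apply: (hS' x) => [v ?|]; first by apply: xy; right.
  by apply/h/(hS y) => // v ?; apply/esym/xy; left.
- exists (some @^-1` S) => [|x y xy h m].
    by apply: finite_preimage => // u v _ _ [].
  by apply: hS (h m) => -[v|] //= /xy.
Qed.

Lemma conjunction V (D : set (formula L V)) : finite_set D ->
  exists phi, forall x : V -> M, sat phi x <-> forall psi, D psi -> sat psi x.
Proof.
move=> /finite_seqP[s ->]; elim: s => [|psi s [phi IH]].
  by exists (Neg Bot) => x; split=> // _ phi.
exists (And psi phi) => x; rewrite sat_And IH; split.
  move=> [h1 h2] chi /=; rewrite inE => /orP[/eqP->//|]; exact: h2.
move=> h; split=> [|chi]; first by apply: h; rewrite /= mem_head.
by move=> chis; apply: h; rewrite /= inE chis orbT.
Qed.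

(** The variables outside s are read through r, which may land in any other type of
   variables. Each step of the induction moves one variable of s into a fresh [None],
   as quantifiers bind it; the map r makes room for that. *)
Lemma exists_elimination (V : eqType) W (s : seq V) (r : V -> W) phi :
  exists psi, forall z : W -> M, sat psi z <->
    exists2 y : V -> M, (forall v, v \notin s -> y v = z (r v)) & sat phi y.
Proof.
elim: s W r => [|v s IH] W r.
  exists (rename r phi) => z; rewrite sat_rename; split=> [h|[y yz]].
    by exists (z \o r).
  by have -> : z \o r = y by apply: funext => v; rewrite yz.
have [psi psiP] := IH _ (fun u => if u == v then None else Some (r u)).
exists (Ex psi) => z; rewrite sat_Ex; split=> [[m /psiP[y yz hy]]|[y yz hy]].
  exists y => // u; rewrite inE negb_or => /andP[uv us].
  by rewrite yz // (negbTE uv).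
exists (y v); apply/psiP; exists y => // u us.
by case: eqP => [->//|/eqP uv]; rewrite yz // inE negb_or uv.
Qed.

End Syntax.

(** * Compactness for a small number of variables *)

Section Compactness.
Variables (L : language) (kappa : Type) (M : structure L).
Hypothesis satM : saturated M kappa.
Variables (V : Type) (Sigma : set (formula L V)).

(** [G] plays the role of the graph of a partial realization of [Sigma]. Only finite parts of
   [G] are tested, so that the condition passes to unions of chains. *)
Definition extendable (G : set (V * M)) : Prop := forall D l,
  finite_set D -> D `<=` Sigma -> finite_set l -> l `<=` G ->
  exists x : V -> M, (forall phi, D phi -> sat phi x) /\
                     (forall p, l p -> x p.1 = p.2).

Lemma finite_sub_chain X (F : set (set X)) (l : set X) :
  total_on F subset -> F !=set0 -> finite_set l -> l `<=` \bigcup_(A in F) A ->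
  exists2 A, F A & l `<=` A.
Proof.
move=> totF [A0 FA0]; elim/Pchoice: X => X in F l totF A0 FA0 *.
move=> /finite_seqP[s ->]; elim: s => [_|x s IH sF]; first by exists A0.
have [y /= ys|A FA sA] := IH; first by apply: sF; rewrite /= inE ys orbT.
have [B FB Bx] := sF x (mem_head _ _).
have [AB|BA] := totF _ _ FA FB.
  by exists B => // y /=; rewrite inE => /orP[/eqP->//|/sA/AB].
by exists A => // y /=; rewrite inE => /orP[/eqP->|/sA//]; exact: BA.
Qed.

Lemma extendable_functional G : extendable G ->
  forall v m m', G (v, m) -> G (v, m') -> m = m'.
Proof.
move=> extG v m m' Gm Gm'.
have [|//|||x [_ xl]] := extG set0 [set (v, m); (v, m')].
- exact: finite_set0.
- exact: finite_set2.
- by move=> _ [->|->].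
by have <- : x v = m := xl (v, m) (or_introl erefl); exact: xl (v, m') (or_intror erefl).
Qed.

(** The value m has to realize the type over the values of [G] that consists of the
   consequences of [Sigma] and [G] in the variable v. It is in one variable over a
   small set, so saturation applies. Conversely, whenever m satisfies the formula
   obtained from a finite part of [Sigma] by quantifying out the variables outside v
   and the domain of [G], this finite part has a solution with value m at v. *)
Lemma extendable_step G v : small kappa V -> extendable G ->
  (forall m, ~ G (v, m)) -> exists m, extendable ((v, m) |` G).
Proof.
move=> sV extG nGv; have funG := extendable_functional extG.
pose A := snd @` G.
have sA : small kappa A.
  have /choice[u uG] (a : A) : exists u, G (u, val a).
    by have [[u m] Gum /= <-] := set_valP a; exists u.
  apply: small_embeds sV; exists u => a a' aa'; apply/val_inj/(funG (u a)) => //.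
  by rewrite aa'.
pose Sv : set (formula L (unit + A)) := [set psi | exists D l,
  [/\ finite_set D, D `<=` Sigma, finite_set l, l `<=` G & forall y : V -> M,
    (forall phi, D phi -> sat phi y) -> (forall p, l p -> y p.1 = p.2) ->
    sat psi (join (fun=> y v) val)]].
have [D' D'fin D'S|m mP] := satM sA (Sigma := Sv).
  have /choice[Dl DlP] psi : exists Dl : set (formula L V) * set (V * M), D' psi ->
      [/\ finite_set Dl.1, Dl.1 `<=` Sigma, finite_set Dl.2, Dl.2 `<=` G &
        forall y : V -> M, (forall phi, Dl.1 phi -> sat phi y) ->
          (forall p, Dl.2 p -> y p.1 = p.2) ->
          sat psi (join (fun=> y v) val)].
    have [/D'S[D [l DlP]]|nD] := pselect (D' psi); first by exists (D, l).
    by exists (set0, set0).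
  have [||||x [xD xl]] := extG (\bigcup_(psi in D') (Dl psi).1)
                               (\bigcup_(psi in D') (Dl psi).2).
  - by apply: bigcup_finite => // psi /DlP[].
  - by move=> phi [psi /DlP[_ + _ _ _] h]; apply.
  - by apply: bigcup_finite => // psi /DlP[].
  - by move=> phi [psi /DlP[_ _ _ + _] h]; apply.
  exists (x v) => psi D'psi; have [_ _ _ _] := DlP _ D'psi; apply.
    by move=> phi h; apply: xD; exists psi.
  by move=> p h; apply: xl; exists psi.
exists m => D l Dfin DS lfin lG.
pose l' := l `&` G.
have [phi phiP] := conjunction M Dfin.
have [S Sfin Ssup] := sat_support M phi.
have /choice[r rP] u : exists w : unit + A,
    (exists2 a : A, l' (u, val a) & w = inr a) \/
    (forall a, ~ l' (u, a)) /\ w = inl tt.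
  have [[a la]|/forallNP nl] := pselect (exists a, l' (u, a)); last first.
    by exists (inl tt); right.
  have Aa : A a by exists (u, a) => //; case: la.
  by exists (inr (SigSub (mem_set Aa))); left; exists (SigSub (mem_set Aa)).
have rv : r v = inl tt by have [[a [_ /nGv]]|[]] := rP v.
have [s sS] : exists s : seq {classic V}, S = [set` s] by exact/finite_seqP.
(* the variables to quantify out; v and the variables with a value in l' become
   parameters *)
pose hidden (u : {classic V}) := `[< u <> v /\ forall a, ~ l' (u, a) >].
have [psi psiP] := exists_elimination M [seq u <- s | hidden u] (r : {classic V} -> _) phi.
have : Sv psi.
  exists D, l'; split=> //; first exact: finite_setIl.
    exact: subIsetr.
  move=> y yD yl; apply/psiP.
  exists (fun u : {classic V} => if u \in [seq u <- s | hidden u] then y u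
    else join (fun=> y v) val (r u)) => [u /negbTE->//|].
  apply: (Ssup y); last exact/phiP.
  move=> u; rewrite sS /= => us; rewrite mem_filter us andbT.
  case: ifPn => // /asboolPn/not_andP[/contrapT->|]; first by rewrite rv.
  by have [[a la -> _]|[nl _ /(_ nl)//]] := rP u; rewrite (yl _ la).
move=> /mP/psiP[y yz yphi]; exists y; split=> [chi|[u a] /[dup] lua /lG].
  exact: (phiP y).1.
move=> /= [[-> ->]|Gua].
  rewrite yz ?rv // mem_filter negb_and; apply/orP; left.
  by apply/asboolPn => -[].
rewrite yz.
  have [[a' la' ->]|[nl _]] := rP u; last by case: (nl a).
  by apply: (funG u) Gua => /=; case: la'.
by rewrite mem_filter negb_and; apply/orP; left; apply/asboolPn => -[_ /(_ a)]; apply.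
Qed.

(** A maximal extendable graph is total by [extendable_step], and a formula only
   involves finitely many variables. *)
Lemma compactness : small kappa V ->
  (forall D, finite_set D -> D `<=` Sigma ->
     exists x : V -> M, forall phi, D phi -> sat phi x) ->
  exists x : V -> M, forall phi, Sigma phi -> sat phi x.
Proof.
move=> sV finS.
have [F FP totF D l Df DS lf lF|G [extG maxG]] := @Zorn_bigcup _ extendable.
  have [F0|nF0] := pselect (F !=set0).
    have [A FA lA] := finite_sub_chain totF F0 lf lF.
    exact: (FP _ FA).
  have [x xD] := finS _ Df DS; exists x; split=> // p /lF[A FA _].
  by case: nF0; exists A.
have /choice[x xG] v : exists m, G (v, m).
  apply: contrapT => /forallNP nGv.
  have [m extm] := extendable_step sV extG nGv.
  apply: maxG extm; split=> [p ?|]; first by right.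
  by move=> /(_ (v, m) (or_introl erefl))/nGv.
exists x => phi Sphi.
have [S Sfin Ssup] := sat_support M phi.
have [||||y [yD yl]] := extG [set phi] [set (v, x v) | v in S].
- exact: finite_set1.
- by move=> _ ->.
- exact: finite_image.
- by move=> _ [v _ <-].
apply: (Ssup y) (yD _ erefl) => v Sv.
by rewrite (yl (v, x v)) //; exists v.
Qed.

End Compactness.

(** * Automorphisms and their limits *)

Section Automorphisms.
Variables (L : language).

Lemma eval_hom (N N' : structure L) (h : N -> N') :
  (forall s (args : 'I_(fun_ar s) -> N), h (fun_int args) = fun_int (h \o args)) ->
  forall V (x : V -> N) t, h (eval x t) = eval (h \o x) t.
Proof.
move=> hf V x; elim=> //= s args IH; rewrite hf; congr fun_int.
by apply: funext => i; exact: IH.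
Qed.

Lemma sat_iso (N N' : structure L) (h : N -> N') : bijective h ->
  (forall s (args : 'I_(fun_ar s) -> N), h (fun_int args) = fun_int (h \o args)) ->
  (forall r (args : 'I_(rel_ar r) -> N), rel_int args <-> rel_int (h \o args)) ->
  forall V (phi : formula L V) (x : V -> N), sat phi x <-> sat phi (h \o x).
Proof.
move=> hb hf hr V; elim=> [|{}V t u|{}V s args|{}V phi IH psi IH'|{}V phi IH] x //=.
- by rewrite -!(eval_hom hf); split=> [->//|/(bij_inj hb)].
- rewrite hr.
  suff -> : h \o (fun i => eval x (args i)) = (fun i => eval (h \o x) (args i)) by [].
  by apply: funext => i /=; rewrite (eval_hom hf).
- by rewrite IH IH'.
- have e m : h \o (fun o => oapp x m o) = (fun o => oapp (h \o x) (h m) o).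
    by apply: funext => -[].
  case: hb => h' h'K hK; split=> H m; last by rewrite IH e; exact: H.
  by have := H (h' m); rewrite IH e hK.
Qed.

Variable M : structure L.

Lemma sat_aut f : automorphism M f -> forall V (phi : formula L V) (x : V -> M),
  sat phi x <-> sat phi (f \o x).
Proof. by move=> [fb ff fr]; exact: sat_iso. Qed.

Lemma aut_id : automorphism M id.
Proof. by split=> //; exists id. Qed.

Lemma aut_comp f g : automorphism M f -> automorphism M g ->
  automorphism M (f \o g).
Proof.
move=> [fb ff fr] [gb gf gr]; split; first exact: bij_comp.
  by move=> s args /=; rewrite gf ff.
by move=> r args; rewrite gr fr.
Qed.

Lemma aut_cancel f g : automorphism M f -> cancel f g -> cancel g f ->
  automorphism M g.
Proof.
move=> [fb ff fr] fK gK; split; first by exists f.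
  move=> s args; apply: (can_inj fK); rewrite gK ff; congr fun_int.
  by apply: funext => i /=; rewrite gK.
move=> r args; rewrite [X in _ <-> X]fr; suff -> : f \o (g \o args) = args by [].
by apply: funext => i /=; rewrite gK.
Qed.

Lemma aut_inv f : automorphism M f ->
  exists g, [/\ automorphism M g, cancel f g & cancel g f].
Proof. by move=> fA; have [[g fK gK] _ _] := fA; exists g; split=> //; exact: aut_cancel fK gK. Qed.

End Automorphisms.

Section Limits.
Variables (L : language) (kappa : Type) (M : structure L).
Variables (T : set (sentence L)).
Hypothesis monM : monster T kappa M.

Lemma monster_small_nat : small kappa nat.
Proof.
have [_ sf _ _] := monM; apply: small_embeds sf.
by exists (fun n => Eq (Var L n) (Var L n)) => m n [].
Qed.

(** The family is indexed by words because each letter then acts on the indices, by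
   (w, v) |-> (d :: w, v). So a tuple with the same type as the family again carries partial
   elementary maps, one for each letter. *)
Definition word_images (D V : Type) (g : D -> M -> M) (p : V -> M) :
    seq D * V -> M :=
  fun wv => foldr (fun d x => g d x) (p wv.2) wv.1.

(** The limit is a realization t of all the formulas that eventually hold of the
   images of p under the words: compactness provides t. Homogeneity allows to keep
   the images under the empty word at p. Since each g i d is an automorphism,
   the tuples t (w, v) and t (d :: w, v) have the same type, so homogeneity yields the
   automorphism h d; by construction t lists the images of p under the words in h. *)
Lemma limit_automorphisms (D : countType) (Idx : Type) (F : set_system Idx)
    (FF : ProperFilter F) (g : Idx -> D -> M -> M)
    (gA : forall i d, automorphism M (g i d))
    (V : Type) (sV : small kappa V) (p : V -> M) :
  exists2 h : D -> M -> M, (forall d, automorphism M (h d)) &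
    forall phi : formula L (seq D * V),
      (\forall i \near F, sat phi (word_images (g i) p)) ->
      sat phi (word_images h p).
Proof.
have [_ _ satM homM] := monM.
have sW := small_words monster_small_nat D sV.
pose Sigma : set (formula L (seq D * V)) :=
  [set phi | \forall i \near F, sat phi (word_images (g i) p)].
have [D' D'fin D'S|t0 t0S] := compactness satM (Sigma := Sigma) sW.
  suff /filter_ex[i iD] : \forall i \near F,
      forall phi, D' phi -> sat phi (word_images (g i) p).
    by exists (word_images (g i) p).
  move: D'fin D'S => /finite_seqP[s ->]; elim: s => [_|phi s IH sS].
    by near=> i.
  have h1 := sS phi (mem_head _ _).
  have /IH h2 : [set` s] `<=` Sigma.
    by move=> chi /= chis; apply: sS; rewrite /= inE chis orbT.
  near=> i => chi /=; rewrite inE => /orP[/eqP->|].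
    by near: i.
  by move: chi; near: i.
have [|k kA kt0] := homM V sV (fun v => t0 ([::], v)) p.
  have pos phi : sat phi p -> sat phi (fun v => t0 ([::], v)).
    move=> hphi; suff : Sigma (rename (fun v => ([::], v)) phi).
      by move=> /t0S; rewrite sat_rename.
    by near=> i; rewrite sat_rename.
  by move=> phi; split=> [h|/pos//]; apply: contrapT => /(pos (Neg phi)) /(_ h).
pose t := k \o t0.
have tS phi : Sigma phi -> sat phi t by move=> /t0S; rewrite (sat_aut kA).
have tp v : t ([::], v) = p v by rewrite -kt0.
have /choice[h hP] d : exists h, automorphism M h /\
    forall w v, h (t (w, v)) = t (d :: w, v).
  have [phi|h hA ht] := homM _ sW t (fun wv => t (d :: wv.1, wv.2)).
    have e i : word_images (g i) p \o (fun wv => (d :: wv.1, wv.2)) =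
      g i d \o word_images (g i) p by apply: funext => -[].
    (* preservation of phi by g i d, as a pair of formulas about the words *)
    have S1 : Sigma (Imp phi (rename (fun wv => (d :: wv.1, wv.2)) phi)).
      by near=> i; rewrite /= sat_rename e -(sat_aut (gA i d)).
    have S2 : Sigma (Imp (rename (fun wv => (d :: wv.1, wv.2)) phi) phi).
      by near=> i; rewrite /= sat_rename e -(sat_aut (gA i d)).
    by have := tS _ S1; have := tS _ S2; rewrite /= sat_rename.
  by exists h; split=> // w v; have /(congr1 (@^~ (w, v))) := ht.
exists h => [d|phi /tS]; first by case: (hP d).
suff -> : word_images h p = t by [].
apply: funext => -[w v]; elim: w => [|d w IH] /=; first by rewrite tp.
by rewrite /word_images /= -(hP d).2 -IH.
Unshelve. all: by end_near.
Qed.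

End Limits.

(** * Hyperimaginaries *)

Section Hyperimaginaries.
Variables (L : language) (M : structure L).

Lemma hact_id I (X : set (I -> M)) : hact id X = X.
Proof. by rewrite /hact image_id. Qed.

Lemma hact_comp I (f g : M -> M) (X : set (I -> M)) :
  hact (f \o g) X = hact f (hact g X).
Proof. by rewrite /hact image_comp. Qed.

Lemma hactK I (f g : M -> M) : cancel f g ->
  cancel (@hact M I f) (@hact M I g).
Proof.
move=> fK X; rewrite -hact_comp -[RHS]hact_id; congr hact.
by apply: funext => x /=; rewrite fK.
Qed.

Lemma hact_hpair I J (f : M -> M) (X : set (I -> M)) (Y : set (J -> M)) :
  hact f (hpair X Y) = hpair (hact f X) (hact f Y).
Proof.
apply/seteqP; split=> [_ [z [Xz Yz] <-]|z [[x Xx xz] [y Yy yz]]].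
  by split; [exists (z \o inl)|exists (z \o inr)].
exists (join x y); first by [].
by apply: funext => -[i|j]; [have := congr1 (fun w => w i) xz
                            |have := congr1 (fun w => w j) yz].
Qed.

Lemma tdrel_aut I (F : tdeq M I) f x y : automorphism M f ->
  F x y <-> F (f \o x) (f \o y).
Proof.
move=> fA; have [Sigma FS] := tdrel_def F; rewrite !FS.
have e : join (f \o x) (f \o y) = f \o join x y by apply: funext => -[].
rewrite e; split=> h phi /h; first exact: (sat_aut fA phi _).1.
exact: (sat_aut fA phi _).2.
Qed.

Lemma hact_hclass I (F : tdeq M I) f x : automorphism M f ->
  hact f (hclass F x) = hclass F (f \o x).
Proof.
move=> fA; have [g [gA fK gK]] := aut_inv fA.
apply/seteqP; split=> [_ [y /= Fxy <-]|y /= Fxy].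
  exact: (tdrel_aut F x y fA).1.
have fgy : f \o (g \o y) = y by apply: funext => i /=; rewrite gK.
by exists (g \o y) => //; apply/(tdrel_aut F _ _ fA); rewrite fgy.
Qed.

Lemma hclass_eq I (F : tdeq M I) x y : hclass F x = hclass F y <-> F x y.
Proof.
split=> [e|Fxy]; last first.
  apply/seteqP; split=> z; last exact: tdrel_trans.
  exact/tdrel_trans/tdrel_sym.
by have : hclass F y y := tdrel_refl F y; rewrite -e.
Qed.

Lemma tdrel_pair_def I J (F : tdeq M I) (R : tdeq M J) :
  exists Sigma : set (formula L ((I + J) + (I + J))), forall x y : I + J -> M,
    (F (x \o inl) (y \o inl) /\ R (x \o inr) (y \o inr)) <->
    (forall phi, Sigma phi -> sat phi (join x y)).
Proof.
have [S FS] := tdrel_def F; have [S' RS] := tdrel_def R.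
pose r := join (fun i : I => inl (inl i)) (fun i => inr (inl i)) : _ -> (I + J) + (I + J).
pose r' := join (fun j : J => inl (inr j)) (fun j => inr (inr j)) : _ -> (I + J) + (I + J).
exists ([set rename r phi | phi in S] `|` [set rename r' phi | phi in S']) => x y.
have e : join x y \o r = join (x \o inl) (y \o inl) by apply: funext => -[].
have e' : join x y \o r' = join (x \o inr) (y \o inr) by apply: funext => -[].
rewrite FS RS; split=> [[h h'] _ [[phi Sphi <-]|[phi Sphi <-]]|h].
- by rewrite sat_rename e; exact: h.
- by rewrite sat_rename e'; exact: h'.
- split=> phi Sphi.
    by rewrite -e -sat_rename; apply: h; left; exists phi.
  by rewrite -e' -sat_rename; apply: h; right; exists phi.
Qed.

(** Makes the pair of two hyperimaginaries a single one, see [hpair_hclass]. *)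
Definition tdpair I J (F : tdeq M I) (R : tdeq M J) : tdeq M (I + J).
Proof.
apply: (@TDEq _ _ _ _ _ _ _ (tdrel_pair_def F R)).
- by move=> x; split; exact: tdrel_refl.
- by move=> x y [h h']; split; exact: tdrel_sym.
- by move=> x y z [h1 h1'] [h2 h2']; split; [exact: tdrel_trans h2|exact: tdrel_trans h2'].
Defined.

Lemma hpair_hclass I J (F : tdeq M I) (R : tdeq M J) x y :
  hpair (hclass F x) (hclass R y) = hclass (tdpair F R) (join x y).
Proof. by []. Qed.

End Hyperimaginaries.

(** * Strong automorphisms and Lascar equivalence *)

Section Lascar.
Variables (L : language) (M : structure L) (kappa : Type).
Variables (K : Type) (e : set (K -> M)).
Local Notation Aut := (Aut_over e).
Local Notation Autf := (Autf_over kappa e).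

Lemma Aut_over_id : Aut id.
Proof. by split; [exact: aut_id|exact: hact_id]. Qed.

Lemma Aut_over_comp f g : Aut f -> Aut g -> Aut (f \o g).
Proof.
by move=> [fA fe] [gA ge]; split; [exact: aut_comp|rewrite hact_comp ge].
Qed.

Lemma Aut_over_cancel f g : Aut f -> cancel f g -> cancel g f -> Aut g.
Proof.
move=> [fA fe] fK gK; split; first exact: aut_cancel fK gK.
by rewrite -[in LHS]fe (hactK fK).
Qed.

Lemma Aut_over_inv f : Aut f -> exists g, [/\ Aut g, cancel f g & cancel g f].
Proof.
move=> fA; have [g [_ fK gK]] := aut_inv fA.1.
by exists g; split=> //; exact: Aut_over_cancel fK gK.
Qed.

Lemma Autf_sub f : Autf f -> Aut f.
Proof.
apply: smallest_sub => [|g []//]; split; first exact: Aut_over_id.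
- exact: Aut_over_comp.
- exact: Aut_over_cancel.
Qed.

Lemma generated_subgroup (X : Type) (S : set (X -> X)) : subgroup (generated S).
Proof.
split=> [H [[h _ _] _]//|f g hf hg H HS|f g hf fK gK H HS].
- by have [[_ h _] _] := HS; apply: h; [exact: hf|exact: hg].
- by have [[_ _ h] _] := HS; apply: h fK gK; exact: hf.
Qed.

Lemma Autf_subgroup : subgroup Autf.
Proof. exact: generated_subgroup. Qed.

Lemma Autf_id : Autf id.
Proof. by have [] := Autf_subgroup. Qed.

Lemma Autf_comp f g : Autf f -> Autf g -> Autf (f \o g).
Proof. by have [_ h _] := Autf_subgroup; exact: h. Qed.

Lemma Autf_cancel f g : Autf f -> cancel f g -> cancel g f -> Autf g.
Proof. by have [_ _ h] := Autf_subgroup; exact: h. Qed.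

Lemma Autf_inv f : Autf f -> exists g, [/\ Autf g, cancel f g & cancel g f].
Proof.
move=> fA; have [g [_ fK gK]] := Aut_over_inv (Autf_sub fA).
by exists g; split=> //; exact: Autf_cancel fK gK.
Qed.

Lemma Autf_fix A f : small_model_dcl kappa e A -> automorphism M f ->
  (forall x, A x -> f x = x) -> Autf f.
Proof.
move=> mA fA fix_A; apply: sub_gen_smallest; split; last by exists A.
by split=> //; have [_ _] := mA; apply.
Qed.

Lemma elementary_image (A : set M) g : automorphism M g ->
  elementary A -> elementary (g @` A).
Proof.
move=> gA [cA elA]; have [g' [_ gK g'K]] := aut_inv gA; have [_ gf gr] := gA.
have cgA : fun_closed (g @` A).
  move=> s args /(_ _)/cid2-/all_sig2[x Ax xE].
  exists (fun_int x); first exact: (cA _ _ Ax).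
  by rewrite gf; congr fun_int; apply: funext => i /=.
have gval (x : A) : (g @` A) (g (val x)) by exists (val x) => //; exact: set_valP.
have g'val (x : (g @` A : set M)) : A (g' (val x)).
  by have [y Ay <-] := set_valP x; rewrite gK.
pose h (x : substructure cA) : substructure cgA := SigSub (mem_set (gval x)).
pose h' (x : substructure cgA) : substructure cA := SigSub (mem_set (g'val x)).
have hK : cancel h h' by move=> x; apply: val_inj => /=; rewrite gK.
have h'K : cancel h' h by move=> x; apply: val_inj => /=; rewrite g'K.
exists cgA => V phi x.
have -> : x = h \o (h' \o x) by apply: funext => v /=; rewrite h'K.
rewrite -(@sat_iso L (substructure cA) (substructure cgA) h); last first.
- by move=> r args /=; rewrite gr.
- move=> s args; apply: val_inj => /=; rewrite gf; congr fun_int.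
- by exists h'.
by rewrite elA (sat_aut gA).
Qed.

Lemma small_model_image A g : Aut g ->
  small_model_dcl kappa e A -> small_model_dcl kappa e (g @` A).
Proof.
move=> gA [elA sA dA]; have [g' [g'A gK g'K]] := Aut_over_inv gA; split.
- exact: elementary_image gA.1 elA.
- have g'val (x : (g @` A : set M)) : A (g' (val x)).
    by have [y Ay <-] := set_valP x; rewrite gK.
  apply: small_embeds sA; exists (fun x => SigSub (mem_set (g'val x))).
  by move=> x y [/(can_inj g'K)/val_inj].
- move=> f fA ffix.
  have : hact (g' \o (f \o g)) e = e.
    apply: dA; first exact: (aut_comp g'A.1 (aut_comp fA gA.1)).
    by move=> x Ax /=; rewrite ffix ?gK //; exists x.
  rewrite 2!hact_comp gA.2 => /(congr1 (hact g)).
  by rewrite (hactK g'K) gA.2.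
Qed.

(** Conjugation by g turns the stabilizer of a model A into that of g(A), so it permutes
   the generators of Autf_e. *)
Lemma Autf_conj f g g' : Aut g -> cancel g g' -> cancel g' g ->
  Autf f -> Autf (g \o f \o g').
Proof.
move=> gA gK g'K; have g'A := Aut_over_cancel gA gK g'K.
move: f; suff: Autf `<=` [set f | Autf (g \o f \o g')] by apply.
apply: smallest_sub => [|f [fA [A mA ffix]]].
  split=> /=.
  - suff -> : g \o id \o g' = id by exact: Autf_id.
    by apply: funext => x /=; rewrite g'K.
  - move=> f h hf hh.
    suff -> : g \o (f \o h) \o g' = (g \o f \o g') \o (g \o h \o g') by exact: Autf_comp.
    by apply: funext => x /=; rewrite gK.
  - move=> f h hf fK hK; apply: (Autf_cancel hf) => x /=.
      by rewrite gK fK g'K.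
    by rewrite gK hK g'K.
apply: (Autf_fix (small_model_image gA mA)).
  exact: (aut_comp (aut_comp gA.1 fA.1) g'A.1).
by move=> _ [x Ax <-] /=; rewrite gK ffix.
Qed.

Section LascarEq.
Variable I : Type.
Implicit Types u v w : set (I -> M).
Local Notation "u ~L v" := (Lascar_eq kappa e u v) (at level 70).

Lemma Lascar_sym u v : u ~L v -> v ~L u.
Proof.
move=> [f fA <-]; have [g [gA fK _]] := Autf_inv fA.
by exists g => //; exact: hactK.
Qed.

Lemma Lascar_trans v u w : u ~L v -> v ~L w -> u ~L w.
Proof.
move=> [f fA <-] [g gA <-]; exists (g \o f); first exact: Autf_comp.
exact: hact_comp.
Qed.

Lemma Lascar_act f u v : Aut f -> u ~L v -> hact f u ~L hact f v.
Proof.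
move=> fA [h hA <-]; have [g [_ fK gK]] := Aut_over_inv fA.
by exists (f \o h \o g); [exact: Autf_conj|rewrite 2!hact_comp (hactK fK)].
Qed.

Lemma Lascar_actI f u v : Aut f -> hact f u ~L hact f v -> u ~L v.
Proof.
move=> fA; have [g [gA fK _]] := Aut_over_inv fA.
by move=> /(Lascar_act gA); rewrite !(hactK fK).
Qed.

End LascarEq.

Section LascarEqSeq.
Variables (Lam I : Type).
Implicit Types u v w : Lam -> set (I -> M).
Local Notation "u ~L v" := (Lascar_eq_seq kappa e u v) (at level 70).

Lemma Lascar_seq_refl u : u ~L u.
Proof. by exists id => [|i]; [exact: Autf_id|exact: hact_id]. Qed.

Lemma Lascar_seq_sym u v : u ~L v -> v ~L u.
Proof.
move=> [f fA fE]; have [g [gA fK _]] := Autf_inv fA.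
by exists g => // i; rewrite -fE; exact: hactK.
Qed.

Lemma Lascar_seq_trans v u w : u ~L v -> v ~L w -> u ~L w.
Proof.
move=> [f fA fE] [g gA gE]; exists (g \o f) => [|i]; first exact: Autf_comp.
by rewrite hact_comp fE.
Qed.

End LascarEqSeq.

End Lascar.

(** * G-compactness as a closedness condition on types *)

Section GCompact.
Variables (L : language) (M : structure L) (kappa : Type).
Variables (T : set (sentence L)) (monM : monster T kappa M).
Variables (K : Type) (e : set (K -> M)).
Local Notation Aut := (Aut_over e).
Local Notation Autf := (Autf_over kappa e).

Lemma lcoset_Autf f : lcoset f Autf = lcoset id Autf <-> Autf f.
Proof.
split=> [h|fA].
  have : lcoset f Autf f by exists id => //; exact: Autf_id.
  by rewrite h => -[g gA <-].
have [g [gA fK gK]] := Autf_inv fA.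
apply/seteqP; split=> _ [h hA <-] /=.
  by exists (f \o h) => //; exact: Autf_comp.
exists (g \o h); first exact: Autf_comp.
by apply: funext => x /=; rewrite gK.
Qed.

(** Some automorphism k fixing B takes f to f' on A. Then f' and k f differ by an automorphism
   that fixes A, and both this and k are strong. *)
Lemma tp_image_Autf A B f f' :
  small_model_dcl kappa e A -> small_model_dcl kappa e B -> Aut f -> Aut f' ->
  tp_image A B f = tp_image A B f' -> Autf f -> Autf f'.
Proof.
move=> mA mB fA f'A tpE fL; have [_ _ _ homM] := monM.
have sAB : small kappa (A + B).
  by apply: (small_sum (monster_small_nat monM)); [case: mA|case: mB].
have [|k kA kE] := homM _ sAB (join (fun x : A => f (val x)) (fun x : B => val x))
                            (join (fun x : A => f' (val x)) (fun x : B => val x)).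
  by move=> phi; rewrite -[X in X <-> _]/(tp_image A B f phi) tpE.
have kfix x : B x -> k x = x.
  by move=> Bx; have := congr1 (fun w => w (inr (SigSub (mem_set Bx)))) kE.
have kf x : A x -> k (f x) = f' x.
  by move=> Ax; have := congr1 (fun w => w (inl (SigSub (mem_set Ax)))) kE.
have kL := Autf_fix mB kA kfix.
have [f1 [f1A f'K f1K]] := Aut_over_inv f'A.
have hL : Autf (f1 \o (k \o f)).
  apply: (Autf_fix mA); first exact: (aut_comp f1A.1 (aut_comp kA fA.1)).
  by move=> x Ax /=; rewrite kf.
have [h [hA hK h'K]] := Autf_inv hL.
suff -> : f' = (k \o f) \o h by exact: (Autf_comp (Autf_comp kL fL) hA).
by apply: funext => x; apply: (can_inj f1K); rewrite f'K -[LHS]h'K.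
Qed.

Hypothesis gcM : G_compact kappa e.

(** The set of types tp(f(A)/B) with f strong is the preimage of the trivial subgroup, hence
   closed in S_A(B). So if h is not strong, a basic neighbourhood of tp(h(A)/B), given by
   finitely many formulas, misses it; the negation of their conjunction holds for
   all strong automorphisms but not for h. *)
Lemma G_compact_closed : exists A B : set M,
  [/\ small_model_dcl kappa e A, small_model_dcl kappa e B &
    forall h, Aut h ->
    (forall phi : formula L (A + B),
      (forall f, Autf f -> sat phi (join (fun x => f (val x)) val)) ->
      sat phi (join (fun x => h (val x)) val)) -> Autf h].
Proof.
have [A [B [mA mB clAB]]] := gcM; exists A, B; split=> // h hA hphi.
apply: contrapT => nh.
(* the open sets of the Galois group pull back to traces of unions of finite
   intersections of sets of types that contain a given formula *)
have /closed_openC := clAB; rewrite -[open _]/(open (_ @^-1` _)) => -[W [D DW <-] WE].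
(* by tp_image_Autf, the automorphism chosen to define the image of a type in the
   Galois group is strong iff f is *)
have type_ok f (fA : Aut f) : Autf f <->
    ~ ((set_val : type_set e A B -> _) @^-1` (\bigcup_(i in D) i)) (SigSub (mem_set (imageP _ fA))).
  rewrite WE /= not_notP /type_to_GalL; case: cid2 => f' f'A /= tpE.
  rewrite /GalL_proj /= lcoset_Autf.
  by split; apply: (tp_image_Autf mA mB).
have : ~ Autf h by [].
rewrite (type_ok h hA) not_notP => -[X DX /= Xh].
have [s _ sX] := DW _ DX.
have [psi psiP] := @conjunction _ M (A + B)%type _ (finite_fset s).
have : sat (Neg psi) (join (fun x : A => h (val x)) (fun x : B => val x)).
  apply: hphi => f fL /psiP fs.
  have fA := Autf_sub fL; have := fL; rewrite (type_ok f fA); apply.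
  by exists X => //=; rewrite -sX => phi /fs.
by apply; apply/psiP => phi sphi; move: Xh; rewrite -sX => /(_ _ sphi).
Qed.

End GCompact.

(** * Separating distinct Lascar classes by finitely many formulas *)

Section Separation.
Variables (L : language) (M : structure L) (kappa : Type).
Variables (T : set (sentence L)) (monM : monster T kappa M).
Variables (K : Type) (sK : small kappa K) (E : tdeq M K) (a : K -> M).
Variables (e : set (K -> M)) (he : e = hclass E a).
Hypothesis gcM : G_compact kappa e.
Local Notation Aut := (Aut_over e).
Local Notation Autf := (Autf_over kappa e).
Local Notation "u ~L v" := (Lascar_eq kappa e u v) (at level 70).

Lemma Aut_overE f : automorphism M f -> Aut f <-> E a (f \o a).
Proof.
move=> fA; rewrite -hclass_eq -hact_hclass // -he.
by split=> [[_ ->]|].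
Qed.

(** The relation is a conjunction of formulas about the images of p, and each of these
   formulas passes to the limit. *)
Lemma limit_tdrel (D : Type) (Idx : Type) (g : Idx -> D -> M -> M)
    (h : D -> M -> M) (V : Type) (p : V -> M) :
  (forall phi : formula L (seq D * V),
    (forall i, sat phi (word_images (g i) p)) -> sat phi (word_images h p)) ->
  forall (N : Type) (G : tdeq M N) (r r' : N -> seq D * V),
  (forall i, G (word_images (g i) p \o r) (word_images (g i) p \o r')) ->
  G (word_images h p \o r) (word_images h p \o r').
Proof.
move=> lim N G r r' hG; have [Sigma GS] := tdrel_def G.
have joinE (x : seq D * V -> M) : join (x \o r) (x \o r') = x \o join r r'.
  by apply: funext => -[].
apply/(GS _ _) => phi Sphi; rewrite joinE -sat_rename; apply: lim => i.
by rewrite sat_rename -joinE; exact: (GS _ _).1 (hG i) _ Sphi.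
Qed.

Definition agree_on N (A : set M) (D : seq (formula L (N + A))) (x y : N -> M) :=
  forall phi, phi \in D -> sat phi (join x val) <-> sat phi (join y val).

(** Local constancy in g of the triviality of f at g X. Closeness of g and g' is measured on the
   images of one representative d0 by finitely many formulas, which leaves
   finitely many classes of g. *)
Definition separates N (A : set M) (D : seq (formula L (N + A))) (d0 : N -> M)
    (X Y : set (N -> M)) :=
  forall g g' f, Aut g -> Aut g' -> Aut f ->
    agree_on D (g \o d0) (g' \o d0) ->
    hact f (hact g X) ~L hact g X -> ~ hact f (hact g' X) ~L hact g' Y.

(** Suppose that each finite s admits g, g', f violating separation. After composing
   with strong automorphisms, f (g d) = g d and h f (g' d) = g' d' with h strong.
   The limit of these data along the finite sets s satisfies the same equations, with
   g d0 and g' d0 of the same type over A. Hence a strong k maps g d to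
   g' d, and g' d ~ g d = f (g d) ~ f (g' d) ~ h f (g' d) = g' d', against d and d' being
   inequivalent. *)
Lemma separation : exists A : set M,
  forall (N : Type) (sN : small kappa N) (G : tdeq M N) (d0 d1 : N -> M),
  ~ hclass G d0 ~L hclass G d1 ->
  exists D : seq (formula L (N + A)), separates D d0 (hclass G d0) (hclass G d1).
Proof.
have [A [B [mA mB clos]]] := G_compact_closed monM gcM.
exists A => N sN G d0 d1 nd01; apply: contrapT => /forallNP noD.
pose d := hclass G d0; pose d' := hclass G d1.
(* the letters inl false, inl true, inr false, inr true stand for g, g', f and h *)
have /choice[w wP] (s : seq (formula L (N + A))) : exists w : bool + bool -> M -> M,
    [/\ [/\ Aut (w (inl false)), Aut (w (inl true)), Aut (w (inr false)) &
            Autf (w (inr true))],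
        agree_on s (w (inl false) \o d0) (w (inl true) \o d0),
        hact (w (inr false)) (hact (w (inl false)) d) = hact (w (inl false)) d &
        hact (w (inr true)) (hact (w (inr false)) (hact (w (inl true)) d)) =
          hact (w (inl true)) d'].
  have /existsNP[g /existsNP[g' /existsNP[f]]] := noD s.
  move=> /not_implyP[gA /not_implyP[g'A /not_implyP[fA /not_implyP[gg']]]].
  move=> /not_implyP[[h hL hE] /contrapT[k kL kE]].
  have [h' [h'L hK h'K]] := Autf_inv hL.
  exists (fun x => match x with inl false => g | inl true => g'
                 | inr false => h \o f | inr true => k \o h' end); split.
  - split=> //; first exact: Aut_over_comp (Autf_sub hL) fA.
    exact: Autf_comp kL h'L.
  - exact: gg'.
  - by rewrite hact_comp.
  - by rewrite -kE [LHS]hact_comp [X in hact h' X]hact_comp (hactK hK).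
(* the limit is taken along ever larger finite sets of formulas *)
pose Fi : set_system (seq (formula L (N + A))) :=
  filter_from setT (fun s : seq (formula L (N + A)) => [set s' | {subset s <= s'}]).
have FiF : ProperFilter Fi.
  apply: filter_from_proper => [|s _]; last by exists s.
  apply: filter_fromT_filter => [|s s']; first by exists [::].
  by exists (s ++ s') => t st; split=> x xs; apply: st; rewrite mem_cat xs ?orbT.
pose p := join (join (fun x : A => val x) (fun x : B => val x)) (join a (join d0 d1)).
have sV : small kappa ((A + B) + (K + (N + N))).
  have ss := small_sum (monster_small_nat monM).
  by do ?apply: (ss); case: mA; case: mB.
have wAut s x : Aut (w s x).
  by have [[gA g'A fA /Autf_sub hA] _ _ _] := wP s; case: x => -[].
have [|h hA hlim] := @limit_automorphisms L kappa M T monM _ _ Fi FiF w _ _ sV p.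
  by move=> s x; case: (wAut s x).
have hall phi : (forall s, sat phi (word_images (w s) p)) -> sat phi (word_images h p).
  by move=> hs; apply: hlim; exists [::] => // s _; exact: hs.
have limG := limit_tdrel hall.
have hAut x : Aut (h x).
  apply/(Aut_overE (hA x)).
  apply: (limG _ E (fun k => ([::], inr (inl k))) (fun k => ([:: x], inr (inl k)))) => s.
  exact/(Aut_overE (wAut s x).1).
have hL : Autf (h (inr true)).
  apply: clos => // phi phiP.
  pose r : A + B -> seq (bool + bool) * ((A + B) + (K + (N + N))) :=
    join (fun x => ([:: inr true], inl (inl x))) (fun x => ([::], inl (inr x))).
  have rE u : word_images u p \o r = join (fun x => u (inr true) (val x)) val.
    by apply: funext => -[].
  rewrite -rE -sat_rename; apply: hall => s; rewrite sat_rename rE.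
  by apply: phiP; have [[]] := wP s.
set g := h (inl false); set g' := h (inl true); set f := h (inr false).
have fgd : hact f (hact g d) = hact g d.
  rewrite /d !hact_hclass; [|exact: hA..].
  apply/hclass_eq.
  apply: (limG _ G (fun k => ([:: inr false; inl false], inr (inr (inl k))))
                   (fun k => ([:: inl false], inr (inr (inl k))))) => s.
  have [_ _ + _] := wP s.
  by rewrite /d !hact_hclass; [move/hclass_eq|exact: (wAut s _).1..].
have hfg'd : hact (h (inr true)) (hact f (hact g' d)) = hact g' d'.
  rewrite /d /d' !hact_hclass; [|exact: hA..].
  apply/hclass_eq.
  apply: (limG _ G (fun k => ([:: inr true; inr false; inl true], inr (inr (inl k))))
                   (fun k => ([:: inl true], inr (inr (inr k))))) => s.
  have [_ _ _ +] := wP s.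
  by rewrite /d /d' !hact_hclass; [move/hclass_eq|exact: (wAut s _).1..].
have gg' phi : sat phi (join (g \o d0) (val : A -> M)) ->
    sat phi (join (g' \o d0) (val : A -> M)).
  pose r x : N + A -> seq (bool + bool) * ((A + B) + (K + (N + N))) :=
    join (fun k => ([:: inl x], inr (inr (inl k)))) (fun x => ([::], inl (inl x))).
  have rE u x : word_images u p \o r x = join (u (inl x) \o d0) val.
    by apply: funext => -[].
  rewrite -!rE -!sat_rename.
  suff : sat (Imp (rename (r false) phi) (rename (r true) phi)) (word_images h p) by [].
  apply: hlim; exists [:: phi] => // s /(_ phi (mem_head _ _)) phis /=.
  rewrite !sat_rename !rE.
  by have [_ /(_ _ phis) -> _ _] := wP s.
have [_ _ _ homM] := monM.
have sNA : small kappa (N + A).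
  by apply: (small_sum (monster_small_nat monM)) => //; case: mA.
have [|k kA kE] := homM _ sNA (join (g \o d0) val) (join (g' \o d0) val).
  by move=> phi; split=> [/gg'//|h']; apply: contrapT => /(gg' (Neg phi)) /(_ h').
have kL : Autf k.
  apply: (Autf_fix mA kA) => x Ax.
  by have := congr1 (fun w => w (inr (SigSub (mem_set Ax)))) kE.
have kgd : hact k (hact g d) = hact g' d.
  rewrite /d !hact_hclass //; [|exact: hA..].
  congr hclass; apply: funext => i.
  by have := congr1 (fun w => w (inl i)) kE.
have gd_g'd : hact g d ~L hact g' d by exists k.
apply: nd01; apply: (Lascar_actI (hAut (inl true))).
apply: (@Lascar_trans _ _ _ _ _ _ (hact f (hact g' d))).
  apply: Lascar_trans (Lascar_sym gd_g'd) _; rewrite -fgd.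
  exact: Lascar_act (hAut _) gd_g'd.
by exists (h (inr true)).
Qed.

End Separation.

(** * Relativized Lascar groups and their kernels *)

Section Relative.
Variables (L : language) (M : structure L) (kappa : Type).
Variables (K : Type) (e : set (K -> M)).
Local Notation Aut := (Aut_over e).
Variables (Lam I : Type) (q0 : set (I -> M)).
Local Notation q := (realizations e q0).

Lemma realizations_act f x : Aut f -> q x -> q (hact f x).
Proof.
move=> fA [g gA <-]; exists (f \o g); first exact: Aut_over_comp.
exact: hact_comp.
Qed.

Lemma restrE f x : q x -> restr q (hact f) x = hact f x.
Proof. by move=> qx; rewrite /restr /patch mem_set. Qed.

Lemma restr_id : restr q (hact id) = id.
Proof.
by apply: funext => x; rewrite /restr /patch; case: ifP => // _; exact: hact_id.
Qed.

Lemma restr_comp f g : Aut g ->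
  restr q (hact (f \o g)) = restr q (hact f) \o restr q (hact g).
Proof.
move=> gA; apply: funext => x; rewrite /= /restr /patch.
case: ifPn => [|/negbTE qx]; last by rewrite qx.
rewrite inE => /(realizations_act gA) /mem_set ->; exact: hact_comp.
Qed.

(** The elements of Autf^Lam(q), lifted to the automorphisms that restrict to them
   ([Autf_rel_restr]): these compose without reference to q. *)
Definition Lascar_fixing (f : M -> M) : Prop :=
  forall d : Lam -> set (I -> M), (forall i, q (d i)) ->
    Lascar_eq_seq kappa e d (fun i => hact f (d i)).

Lemma Autf_rel_restr f : Aut f ->
  Autf_rel kappa e Lam q (restr q (hact f)) <-> Lascar_fixing f.
Proof.
move=> fA.
have E d : (forall i, q (d i)) ->
    restr q (hact f) \o d = (fun i => hact f (d i)) :> (Lam -> _).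
  by move=> qd; apply: funext => i /=; rewrite restrE.
split=> [[_ h] d qd|h]; first by rewrite -E //; exact: h.
by split=> [|d qd]; [exists f|rewrite E //; exact: h].
Qed.

Lemma Autf_rel_id : Autf_rel kappa e Lam q id.
Proof.
rewrite -restr_id; apply/Autf_rel_restr; first exact: Aut_over_id.
move=> d _; suff -> : (fun i => hact id (d i)) = d by exact: Lascar_seq_refl.
by apply: funext => i; exact: hact_id.
Qed.

Lemma Lascar_fixing_comp f g : Aut g ->
  Lascar_fixing f -> Lascar_fixing g -> Lascar_fixing (f \o g).
Proof.
move=> gA hf hg d qd; apply: (Lascar_seq_trans (hg d qd)).
suff -> : (fun i => hact (f \o g) (d i)) = (fun i => hact f (hact g (d i))).
  by apply: hf => i; exact: realizations_act.
by apply: funext => i; exact: hact_comp.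
Qed.

Lemma Lascar_fixing_cancel f g : Aut g -> cancel g f ->
  Lascar_fixing f -> Lascar_fixing g.
Proof.
move=> gA gK hf d qd.
have := hf (fun i => hact g (d i)) (fun i => realizations_act gA (qd i)).
suff -> : (fun i => hact f (hact g (d i))) = d by exact: Lascar_seq_sym.
by apply: funext => i; exact: hactK.
Qed.

Lemma lcoset_restr_sub f1 f2 g2 : Aut f1 -> Aut f2 -> Aut g2 -> cancel g2 f2 ->
  Lascar_fixing (g2 \o f1) ->
  lcoset (restr q (hact f1)) (Autf_rel kappa e Lam q) `<=`
  lcoset (restr q (hact f2)) (Autf_rel kappa e Lam q).
Proof.
move=> f1A f2A g2A gK fix21 _ [k kF <-].
have [[f3 f3A kE] _] := kF; rewrite -kE in kF *.
have gf1A := Aut_over_comp g2A f1A.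
exists (restr q (hact ((g2 \o f1) \o f3))).
  apply/Autf_rel_restr; first exact: Aut_over_comp.
  by apply: Lascar_fixing_comp => //; exact/Autf_rel_restr.
rewrite -!restr_comp //; last exact: Aut_over_comp.
congr (restr q (hact _)); apply: funext => x /=; exact: gK.
Qed.

Lemma lcoset_restr_eq f1 f2 : Aut f1 -> Aut f2 ->
  (forall g2, Aut g2 -> cancel f2 g2 -> cancel g2 f2 -> Lascar_fixing (g2 \o f1)) ->
  lcoset (restr q (hact f1)) (Autf_rel kappa e Lam q) =
  lcoset (restr q (hact f2)) (Autf_rel kappa e Lam q).
Proof.
move=> f1A f2A fix21.
have [g1 [g1A f1K g1K]] := Aut_over_inv f1A.
have [g2 [g2A f2K g2K]] := Aut_over_inv f2A.
have {}fix21 := fix21 _ g2A f2K g2K.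
apply/seteqP; split; first exact: (lcoset_restr_sub f1A f2A g2A g2K).
apply: (lcoset_restr_sub f2A f1A g1A g1K).
apply: Lascar_fixing_cancel fix21; first exact: Aut_over_comp.
by move=> x /=; rewrite g1K f2K.
Qed.

End Relative.

(** A coset in the kernel is that of some f in Aut_e whose restriction to the
   realizations of b lies in the image coset, which is the trivial one. *)
Lemma kernel_repr (L : language) (M : structure L) (kappa K : Type) (e : set (K -> M))
    (Lam I J : Type) (b : set (I -> M)) (c : set (J -> M)) C :
  GalL_rel_kernel kappa e Lam b c C ->
  exists2 f, Aut_over e f /\ Lascar_fixing kappa e Lam b f &
    C = lcoset (restr (realizations e (hpair b c)) (hact f))
               (Autf_rel kappa e Lam (realizations e (hpair b c))).
Proof.
move=> [[_ [f fA <-] <-] projC]; exists f => //; split=> //.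
apply/Autf_rel_restr => //.
suff : lcoset id (Autf_rel kappa e Lam (realizations e b))
              (restr (realizations e b) (hact f)).
  by move=> [s sF <-].
rewrite -projC; exists f.
  by split=> //; exists id => //; exact: Autf_rel_id.
by exists id => //; exact: Autf_rel_id.
Qed.

Theorem theorem5p6
  (L : language) (T : set (sentence L)) (hT : complete_theory T)
  (kappa : Type) (M : structure L) (hM : monster T kappa M)
  (K I J : Type)
  (hK : small kappa K) (hI : small kappa I) (hJ : small kappa J)
  (E : tdeq M K) (a : K -> M) (F : tdeq M I) (b0 : I -> M)
  (R : tdeq M J) (c0 : J -> M)
  (e : set (K -> M)) (he : e = hclass E a)
  (b : set (I -> M)) (hb : b = hclass F b0)
  (c : set (J -> M)) (hc : c = hclass R c0)
  (hacl : in_acl c b e)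
  (m : nat) (hm : 0 < m) (cs : 'I_m -> set (J -> M))
  (hcs0 : cs (Ordinal hm) = c)
  (hcs_inj : injective cs)
  (hcs : range cs = conjugates b e c)
  (hG : G_compact kappa e)
  (hdag : forall i j : 'I_m, i != j ->
     ~ Lascar_eq kappa e (hpair b (cs i)) (hpair b (cs j))) :
  forall n : nat, 0 < n -> finite_set (GalL_rel_kernel kappa e 'I_n b c).
Proof.
move=> n n0.
set j0 := Ordinal hm in hcs0.
pose d j := hpair b (cs j).
have d0E : hpair b c = d j0 by rewrite /d hcs0.
(* conjugated by g, the automorphism k fixes b and e, so it takes c to some c_j *)
have lift k g : Aut_over e k -> Aut_over e g -> hact k (hact g b) = hact g b ->
    exists j, hact k (hact g (d j0)) = hact g (d j).
  move=> kA gA kb; have [g' [g'A gK g'K]] := Aut_over_inv gA.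
  have uA : Aut_over e (g' \o (k \o g)).
    by apply: Aut_over_comp => //; exact: Aut_over_comp.
  have ub : hact (g' \o (k \o g)) b = b by rewrite 2!hact_comp kb (hactK gK).
  have : conjugates b e c (hact (g' \o (k \o g)) c).
    by exists (g' \o (k \o g)) => //; split=> //; split=> //; case: uA.
  rewrite -hcs => -[j _ jE]; exists j.
  rewrite /d hcs0 jE -{2}ub -hact_hpair 2!hact_comp.
  by rewrite (hactK g'K).
have dag g j : Aut_over e g ->
    Lascar_eq kappa e (hact g (d j0)) (hact g (d j)) -> j = j0.
  move=> gA /(Lascar_actI gA) h.
  by have [//|] := eqVneq j j0; rewrite eq_sym => /hdag /(_ h).
have /choice[cj cjE] j : exists cj, cs j = hclass R cj.
  have : conjugates b e c (cs j) by rewrite -hcs; exists j.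
  by move=> [f [_ [fA _]] <-]; exists (f \o c0); rewrite hc hact_hclass.
have dE j : d j = hclass (tdpair F R) (join b0 (cj j)) by rewrite /d hb cjE.
have sIJ : small kappa (I + J) by exact: (small_sum (monster_small_nat hM)).
have [A [delta deltaP]] : exists (A : set M) (D : seq (formula L ((I + J) + A))),
    forall j, j != j0 -> separates kappa e D (join b0 (cj j0)) (d j0) (d j).
  have [A sep] := separation hM hK he hG; exists A.
  have /choice[D DP] j : exists D : seq (formula L ((I + J) + A)),
      j != j0 -> separates kappa e D (join b0 (cj j0)) (d j0) (d j).
    case: (eqVneq j j0) => [_|nj]; first by exists [::].
    have [|D DP] :=
      sep _ sIJ (tdpair F R) (join b0 (cj j0)) (join b0 (cj j)).
      by rewrite -!dE; apply: hdag; rewrite eq_sym.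
    by exists D => _; rewrite !dE.
  exists (flatten [seq D j | j <- enum 'I_m]) => j nj g g' f gA g'A fA gg'.
  apply: DP => // phi phiD; apply: gg'; apply/flatten_mapP; exists j => //.
  by rewrite mem_enum.
(* agreement on delta has finitely many classes; rep picks an automorphism in each
   class that occurs *)
pose cls g := [ffun i : 'I_(size delta) =>
  `[< sat (tnth (in_tuple delta) i) (join (g \o join b0 (cj j0)) val) >]].
have /choice[rep repP] x : exists r, Aut_over e r /\
    forall g, Aut_over e g -> cls g = x -> cls r = x.
  have [[r [rA rx]]|nr] := pselect (exists r, Aut_over e r /\ cls r = x).
    by exists r.
  by exists id; split=> [|g gA gx]; [exact: Aut_over_id|case: nr; exists g].
have repA x := (repP x).1.
pose good := Lascar_fixing kappa e 'I_n b.
have good1 f g : Aut_over e f -> good f -> Aut_over e g ->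
    exists j, Lascar_eq kappa e (hact f (hact g (d j0))) (hact g (d j)).
  move=> fA fgood gA.
  have [|h hL hE] := fgood (fun=> hact g b); first by move=> _; exists g.
  have [h' [h'L hK' h'K]] := Autf_inv hL.
  have [||j jE] := lift (h' \o f) g _ gA.
  - exact: Aut_over_comp (Autf_sub h'L) fA.
  - by rewrite hact_comp -(hE (Ordinal n0)) (hactK hK').
  by exists j, h' => //; rewrite -hact_comp.
(* a good f that is trivial at the representatives is trivial at all conjugates of
   bc, hence on n-tuples of them *)
have fixing f : Aut_over e f -> good f ->
    (forall x, Lascar_eq kappa e (hact f (hact (rep x) (d j0))) (hact (rep x) (d j0))) ->
    Lascar_fixing kappa e 'I_n (hpair b c) f.
  move=> fA fgood frep.
  have fg g : Aut_over e g -> Lascar_eq kappa e (hact f (hact g (d j0))) (hact g (d j0)).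
    move=> gA; have [j fj] := good1 _ _ fA fgood gA.
    have [jj0|nj] := eqVneq j j0; first by rewrite -{2}jj0.
    case: (deltaP j nj (rep (cls g)) g f) => // phi phid.
    have := (repP (cls g)).2 g gA erefl => /ffunP.
    have idelta : index phi delta < size delta by rewrite index_mem.
    move=> /(_ (Ordinal idelta)); rewrite !ffunE (tnth_nth phi) /= nth_index //.
    by move=> h; split=> /asboolP; [rewrite h|rewrite -h] => /asboolP.
  rewrite d0E => dd /(_ _)/cid2-/all_sig2[g gA gE].
  have [|h hL hE] := fgood (fun i => hact (g i) b); first by move=> i; exists (g i).
  have [h' [h'L hK' h'K]] := Autf_inv hL.
  exists h => // i; rewrite -gE.
  have h'fA : Aut_over e (h' \o f) by exact: Aut_over_comp (Autf_sub h'L) fA.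
  have [|j jE] := lift _ _ h'fA (gA i).
    by rewrite hact_comp -hE (hactK hK').
  have jj0 : j = j0.
    apply: (dag _ _ (gA i)); rewrite -jE; apply: Lascar_trans (Lascar_sym (fg _ (gA i))) _.
    by exists h' => //; rewrite hact_comp.
  by rewrite -[in LHS]jj0 -jE hact_comp (hactK h'K).
have /choice[rf rfP] (C : GalL_rel_kernel kappa e 'I_n b c) : exists f,
    [/\ Aut_over e f, good f & val C =
    lcoset (restr (realizations e (hpair b c)) (hact f))
           (Autf_rel kappa e 'I_n (realizations e (hpair b c)))].
  by have [f [fA fg] fE] := kernel_repr (set_valP C); exists f.
(* the function of representatives that determines a coset C *)
have /choice[tau tauP] (C : GalL_rel_kernel kappa e 'I_n b c) : exists t : {ffun _ -> 'I_m},
    forall x, Lascar_eq kappa e (hact (rf C) (hact (rep x) (d j0))) (hact (rep x) (d (t x))).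
  have [fA fgood _] := rfP C.
  have /choice[t tP] x := good1 _ _ fA fgood (repA x).
  by exists [ffun x => t x] => x; rewrite ffunE.
apply: (@card_le_finite _ _ _
  [set: {ffun {ffun 'I_(size delta) -> bool} -> 'I_m}]); last exact: finite_finset.
apply/card_le_embeds; exists (fun C => SigSub (in_setT (tau C))) => C1 C2 [tau12].
have [f1A f1good C1E] := rfP C1; have [f2A f2good C2E] := rfP C2.
apply: val_inj; rewrite C1E C2E; apply: lcoset_restr_eq => // g2 g2A f2K g2K.
apply: fixing.
- exact: Aut_over_comp.
- by apply: Lascar_fixing_comp => //; exact: Lascar_fixing_cancel f2good.
move=> x; rewrite hact_comp -[X in Lascar_eq _ _ _ X](hactK f2K).
apply: Lascar_act g2A _; apply: Lascar_trans (tauP C1 x) _.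
by rewrite tau12; exact: Lascar_sym (tauP C2 x).
Qed.
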